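(* Fix a base state $(T_+,\alpha_A^+)$ with $T_+>0$, $0<\alpha_A^+<1$. Along the thermodynamic Hugoniot locus $\alpha_A=\alpha_A(T)$ of $(T_+,\alpha_A^+)$, the pressure $p$ strictly increases as the temperature $T$ increases.
   Context: Fixed constants: $\mu_A,\mu_B>0$, $0<\beta<1$, $0<T_A<T_B\le 2T_A$. The independent thermodynamic variables are $T>0$ and $\alpha_A\in(0,1)$; put $$\alpha_B=\frac{\mu_A\alpha_Ae^{-(T_B-T_A)/T}}{\mu_A\alpha_Ae^{-(T_B-T_A)/T}+\mu_B(1-\alpha_A)},\quad \alpha=\beta\alpha_A+(1-\beta)\alpha_B,\quad p=\frac{(1-\alpha_A)(1+\alpha)}{\mu_A\alpha_A\alpha}T^{5/2}e^{-T_A/T}.$$ The values of these quantities at the base state $(T_+,\alpha_A^+)$ are $\alpha_B^+,\alpha^+,p_+$. Let $$H(T,\alpha_A)=T(1+\alpha)\left(4+\frac{p_+}{p}\right)+2\left[\beta\alpha_AT_A+(1-\beta)\alpha_BT_B\right]-T_+(1+\alpha^+)\left(4+\frac{p}{p_+}\right)-2\left[\beta\alpha_A^+T_A+(1-\beta)\alpha_B^+T_B\right].$$ For every $T>0$ the equation $H(T,\alpha_A)=0$ has a unique solution $\alpha_A(T)\in(0,1)$, differentiable in $T$; its graph is the thermodynamic Hugoniot locus of $(T_+,\alpha_A^+)$, and the pressure along it is $p$ evaluated at $(T,\alpha_A(T))$. *)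

(* Defs.v *)
From Stdlib Require Import Reals.

Open Scope R_scope.

(* The constants of the gas mixture are bundled only to avoid repeating five
   arguments; [admissible] carries the standing assumptions on them. *)
Record constants : Type := Constants {
  muA : R;
  muB : R;
  beta : R;
  TA : R;
  TB : R
}.

Definition admissible (c : constants) : Prop :=
  0 < muA c /\ 0 < muB c /\ 0 < beta c < 1 /\
  0 < TA c /\ TA c < TB c /\ TB c <= 2 * TA c.

Definition alphaB (c : constants) (T aA : R) : R :=
  let w := muA c * aA * exp (- (TB c - TA c) / T) in
  w / (w + muB c * (1 - aA)).

Definition alpha (c : constants) (T aA : R) : R :=
  beta c * aA + (1 - beta c) * alphaB c T aA.

(* [Rpower T (5/2)] is the usual power only for [0 < T], the sole range used. *)
Definition pressure (c : constants) (T aA : R) : R :=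
  (1 - aA) * (1 + alpha c T aA) / (muA c * aA * alpha c T aA)
  * Rpower T (5 / 2) * exp (- TA c / T).

Definition ionization_energy (c : constants) (T aA : R) : R :=
  beta c * aA * TA c + (1 - beta c) * alphaB c T aA * TB c.

Definition H (c : constants) (Tp aAp T aA : R) : R :=
  T * (1 + alpha c T aA) * (4 + pressure c Tp aAp / pressure c T aA)
  + 2 * ionization_energy c T aA
  - Tp * (1 + alpha c Tp aAp) * (4 + pressure c T aA / pressure c Tp aAp)
  - 2 * ionization_energy c Tp aAp.

(* [a] solves the Hugoniot equation in (0,1) at every positive temperature, so
   its graph over (0, +oo) is the locus of the base state; values of [a] at
   nonpositive temperatures are irrelevant. *)
Definition is_hugoniot_locus (c : constants) (Tp aAp : R) (a : R -> R) : Prop :=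
  forall T : R, 0 < T -> 0 < a T < 1 /\ H c Tp aAp T (a T) = 0.

(* Main.v *)
(* At fixed temperature the pressure decreases with [aA], and at fixed [aA] it
   increases with the temperature: writing [x = exp (- (TB - TA) / T)], the
   factor [exp (- TA / T) / alpha] is [exp (- (2 TA - TB) / T)] times
   [x / alpha], where [alphaB / x], hence [alpha / x], decreases in [x]; this is
   where [TB <= 2 TA] enters. So if the temperature rises while the pressure
   does not, then [aA] rises, and with it [alphaB], [alpha] and the ionization
   energy; every term of [H] then moves upwards, and [H] cannot vanish at both
   states. *)
Require Import Defs.
From Stdlib Require Import Reals Lra.

Open Scope R_scope.

Lemma Rdiv_le_cross (a b c d : R) :
  0 < b -> 0 < d -> a * d <= c * b -> a / b <= c / d.
Proof.
  intros hb hd h.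
  apply Rmult_le_reg_r with (b * d); [nra|].
  replace (a / b * (b * d)) with (a * d) by (field; lra).
  replace (c / d * (b * d)) with (c * b) by (field; lra).
  exact h.
Qed.

(** Weak in all respects, because the exponent [2 * TA c - TB c] to which it is applied below may
    vanish. *)
Lemma exp_opp_div_le (k T1 T2 : R) :
  0 <= k -> 0 < T1 -> T1 <= T2 -> exp (- k / T1) <= exp (- k / T2).
Proof.
  intros hk h1 h12.
  assert (h : - k / T1 <= - k / T2) by (apply Rdiv_le_cross; nra).
  destruct h as [h | h]; [left; now apply exp_increasing | right; now rewrite h].
Qed.

Lemma alphaB_pos (c : constants) (T a : R) :
  admissible c -> 0 < a < 1 -> 0 < alphaB c T a.
Proof.
  intros (hA & hB & _) ha; unfold alphaB; cbv zeta.
  pose proof (exp_pos (- (TB c - TA c) / T)) as hx.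
  assert (0 < muA c * a * exp (- (TB c - TA c) / T))
    by (repeat apply Rmult_lt_0_compat; lra).
  apply Rdiv_lt_0_compat; nra.
Qed.

Lemma alpha_pos (c : constants) (T a : R) :
  admissible c -> 0 < a < 1 -> 0 < alpha c T a.
Proof.
  intros hc ha; pose proof (alphaB_pos c T a hc ha).
  destruct hc as (_ & _ & hb & _); unfold alpha; nra.
Qed.

Lemma pressure_pos (c : constants) (T a : R) :
  admissible c -> 0 < a < 1 -> 0 < pressure c T a.
Proof.
  intros hc ha; pose proof (alpha_pos c T a hc ha).
  destruct hc as (hA & _); unfold pressure, Rpower.
  repeat apply Rmult_lt_0_compat; try apply exp_pos; try lra.
  apply Rinv_0_lt_compat; repeat apply Rmult_lt_0_compat; lra.
Qed.

(** [alphaB] has the form w / (w + k), where w grows with both variables and k = [muB c * (1 - aA)]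
    shrinks. Cross-multiplied, the claim is w1 k2 <= w2 k1. *)
Lemma alphaB_le (c : constants) (T1 T2 a1 a2 : R) :
  admissible c -> 0 < T1 -> T1 <= T2 -> 0 < a1 -> a1 <= a2 -> a2 < 1 ->
  alphaB c T1 a1 <= alphaB c T2 a2.
Proof.
  intros (hA & hB & _ & _ & hAB & _) h1 h12 ha1 ha12 ha2; unfold alphaB; cbv zeta.
  assert (hx : exp (- (TB c - TA c) / T1) <= exp (- (TB c - TA c) / T2))
    by (apply exp_opp_div_le; lra).
  pose proof (exp_pos (- (TB c - TA c) / T1)) as hx1.
  set (x1 := exp (- (TB c - TA c) / T1)) in *.
  set (x2 := exp (- (TB c - TA c) / T2)) in *.
  assert (hm1 : 0 < muA c * a1) by nra.
  assert (hm : muA c * a1 <= muA c * a2) by nra.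
  assert (hw1 : 0 < muA c * a1 * x1) by nra.
  assert (hw : muA c * a1 * x1 <= muA c * a2 * x2)
    by (apply Rmult_le_compat; lra).
  assert (hk2 : 0 < muB c * (1 - a2)) by nra.
  assert (hk : muB c * (1 - a2) <= muB c * (1 - a1)) by nra.
  apply Rdiv_le_cross; nra.
Qed.

Lemma alpha_le (c : constants) (T1 T2 a1 a2 : R) :
  admissible c -> 0 < T1 -> T1 <= T2 -> 0 < a1 -> a1 <= a2 -> a2 < 1 ->
  alpha c T1 a1 <= alpha c T2 a2.
Proof.
  intros hc h1 h12 ha1 ha12 ha2.
  pose proof (alphaB_le c T1 T2 a1 a2 hc h1 h12 ha1 ha12 ha2).
  destruct hc as (_ & _ & hb & _); unfold alpha; nra.
Qed.

Lemma ionization_energy_le (c : constants) (T1 T2 a1 a2 : R) :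
  admissible c -> 0 < T1 -> T1 <= T2 -> 0 < a1 -> a1 <= a2 -> a2 < 1 ->
  ionization_energy c T1 a1 <= ionization_energy c T2 a2.
Proof.
  intros hc h1 h12 ha1 ha12 ha2.
  pose proof (alphaB_le c T1 T2 a1 a2 hc h1 h12 ha1 ha12 ha2) as hB.
  destruct hc as (_ & _ & hb & hTA & hAB & _); unfold ionization_energy.
  apply Rplus_le_compat; apply Rmult_le_compat_r; nra.
Qed.

(** Division-free form of the monotonicity of [alpha] / x in x = [exp (- (TB c - TA c) / T)]. It
    holds term by term: [beta c * a] / x decreases, and so does [alphaB] / x = m / (m x + k). *)
Lemma alpha_cross_exp_le (c : constants) (T1 T2 a : R) :
  admissible c -> 0 < T1 -> T1 <= T2 -> 0 < a < 1 ->
  alpha c T2 a * exp (- (TB c - TA c) / T1)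
    <= alpha c T1 a * exp (- (TB c - TA c) / T2).
Proof.
  intros (hA & hB & hb & _ & hAB & _) h1 h12 ha.
  assert (hx : exp (- (TB c - TA c) / T1) <= exp (- (TB c - TA c) / T2))
    by (apply exp_opp_div_le; lra).
  pose proof (exp_pos (- (TB c - TA c) / T1)) as hx1.
  unfold alpha, alphaB; cbv zeta.
  set (x1 := exp (- (TB c - TA c) / T1)) in *.
  set (x2 := exp (- (TB c - TA c) / T2)) in *.
  assert (hm : 0 < muA c * a) by nra.
  assert (hk : 0 < muB c * (1 - a)) by nra.
  set (m := muA c * a) in *.
  set (k := muB c * (1 - a)) in *.
  assert (hw1 : 0 < m * x1 + k) by nra.
  assert (hw2 : 0 < m * x2 + k) by nra.
  assert (hfrac : m * x2 / (m * x2 + k) * x1 <= m * x1 / (m * x1 + k) * x2).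
  (* Over the common numerator m x1 x2 only the denominators differ. *)
  { replace (m * x2 / (m * x2 + k) * x1) with (m * x1 * x2 / (m * x2 + k))
      by (field; lra).
    replace (m * x1 / (m * x1 + k) * x2) with (m * x1 * x2 / (m * x1 + k))
      by (field; lra).
    apply Rdiv_le_cross; [lra | lra |].
    apply Rmult_le_compat_l; [repeat apply Rmult_le_pos; lra | nra]. }
  assert (hbA : beta c * a * x1 <= beta c * a * x2)
    by (apply Rmult_le_compat_l; nra).
  nra.
Qed.

Lemma pressure_lt_temperature (c : constants) (T1 T2 a : R) :
  admissible c -> 0 < T1 -> T1 < T2 -> 0 < a < 1 ->
  pressure c T1 a < pressure c T2 a.
Proof.
  intros hc h1 h12 ha.
  pose proof (alpha_cross_exp_le c T1 T2 a hc h1 (Rlt_le _ _ h12) ha) as hcross.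
  pose proof (alpha_pos c T1 a hc ha) as hal1.
  pose proof (alpha_pos c T2 a hc ha) as hal2.
  destruct hc as (hA & hB & hb & hTA & hAB & hBA).
  assert (hp : Rpower T1 (5 / 2) < Rpower T2 (5 / 2))
    by (unfold Rpower; apply exp_increasing;
        pose proof (ln_increasing T1 T2 h1 h12); lra).
  assert (hp1 : 0 < Rpower T1 (5 / 2)) by apply exp_pos.
  (* Splits [TA c] as ([TB c - TA c]) + ([2 * TA c - TB c]), both nonnegative, so both exponentials
     are nondecreasing in T. *)
  assert (hsplit : forall T, 0 < T -> exp (- TA c / T)
    = exp (- (TB c - TA c) / T) * exp (- (2 * TA c - TB c) / T)).
  { intros T hT; rewrite <- exp_plus; f_equal; field; lra. }
  assert (hx : exp (- (TB c - TA c) / T1) <= exp (- (TB c - TA c) / T2))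
    by (apply exp_opp_div_le; lra).
  assert (hy : exp (- (2 * TA c - TB c) / T1) <= exp (- (2 * TA c - TB c) / T2))
    by (apply exp_opp_div_le; lra).
  pose proof (exp_pos (- (TB c - TA c) / T1)) as hx1.
  pose proof (exp_pos (- (2 * TA c - TB c) / T1)) as hy1.
  unfold pressure; rewrite (hsplit T1), (hsplit T2) by lra.
  set (x1 := exp (- (TB c - TA c) / T1)) in *.
  set (x2 := exp (- (TB c - TA c) / T2)) in *.
  set (y1 := exp (- (2 * TA c - TB c) / T1)) in *.
  set (y2 := exp (- (2 * TA c - TB c) / T2)) in *.
  set (r1 := Rpower T1 (5 / 2)) in *.
  set (r2 := Rpower T2 (5 / 2)) in *.
  set (al1 := alpha c T1 a) in *.
  set (al2 := alpha c T2 a) in *.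
  assert (hq : x1 / al1 <= x2 / al2) by (apply Rdiv_le_cross; lra).
  assert (hq1 : 0 < x1 / al1) by (apply Rdiv_lt_0_compat; lra).
  assert (hK : 0 < (1 - a) / (muA c * a)) by (apply Rdiv_lt_0_compat; nra).
  (* Since (1 + al) x / al = x / al + x, every factor depending on T is now nondecreasing;
     strictness comes from the power r. *)
  replace ((1 - a) * (1 + al1) / (muA c * a * al1) * r1 * (x1 * y1))
    with ((1 - a) / (muA c * a) * (r1 * ((x1 / al1 + x1) * y1)))
    by (field; lra).
  replace ((1 - a) * (1 + al2) / (muA c * a * al2) * r2 * (x2 * y2))
    with ((1 - a) / (muA c * a) * (r2 * ((x2 / al2 + x2) * y2)))
    by (field; lra).
  apply Rmult_lt_compat_l; [exact hK|].
  assert (hz1 : 0 < (x1 / al1 + x1) * y1) by (apply Rmult_lt_0_compat; lra).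
  assert (hz : (x1 / al1 + x1) * y1 <= (x2 / al2 + x2) * y2)
    by (apply Rmult_le_compat; lra).
  nra.
Qed.

Lemma pressure_decreasing_ionization (c : constants) (T a1 a2 : R) :
  admissible c -> 0 < T -> 0 < a1 -> a1 < a2 -> a2 < 1 ->
  pressure c T a2 < pressure c T a1.
Proof.
  intros hc hT ha1 ha12 ha2.
  assert (hal : alpha c T a1 <= alpha c T a2) by (apply alpha_le; auto; lra).
  assert (hal1 : 0 < alpha c T a1) by (apply alpha_pos; auto; lra).
  destruct hc as (hA & _); unfold pressure.
  apply Rmult_lt_compat_r; [apply exp_pos|].
  (* [Rpower] is an exponential by definition, so [exp_pos] applies to it too. *)
  apply Rmult_lt_compat_r; [apply exp_pos|].
  set (al1 := alpha c T a1) in *.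
  set (al2 := alpha c T a2) in *.
  (* Both factors 1/a - 1 and 1/al + 1 are positive; the first strictly decreases in a, the second
     weakly because [alpha] grows with a. *)
  replace ((1 - a2) * (1 + al2) / (muA c * a2 * al2))
    with (/ muA c * ((/ a2 - 1) * (/ al2 + 1))) by (field; lra).
  replace ((1 - a1) * (1 + al1) / (muA c * a1 * al1))
    with (/ muA c * ((/ a1 - 1) * (/ al1 + 1))) by (field; lra).
  apply Rmult_lt_compat_l; [now apply Rinv_0_lt_compat|].
  assert (hi : / a2 < / a1) by (apply Rinv_lt_contravar; nra).
  assert (hi2 : 1 < / a2) by (rewrite <- Rinv_1; apply Rinv_lt_contravar; lra).
  assert (hj : / al2 <= / al1) by (apply Rinv_le_contravar; lra).
  assert (hj2 : 0 < / al2) by (apply Rinv_0_lt_compat; lra).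
  nra.
Qed.

(** If a2 < a1, passing from (T1, a1) through (T2, a1) to (T2, a2) raises the pressure at each
    move. *)
Lemma ionization_le_of_pressure_le (c : constants) (T1 T2 a1 a2 : R) :
  admissible c -> 0 < T1 -> T1 < T2 -> 0 < a1 < 1 -> 0 < a2 < 1 ->
  pressure c T2 a2 <= pressure c T1 a1 -> a1 <= a2.
Proof.
  intros hc h1 h12 ha1 ha2 hp.
  destruct (Rle_lt_dec a1 a2) as [h | h]; [exact h|].
  assert (pressure c T2 a1 < pressure c T2 a2)
    by (apply pressure_decreasing_ionization; auto; lra).
  pose proof (pressure_lt_temperature c T1 T2 a1 hc h1 h12 ha1).
  lra.
Qed.

Lemma H_lt_of_pressure_le (c : constants) (Tp aAp T1 T2 a1 a2 : R) :
  admissible c -> 0 < Tp -> 0 < aAp < 1 ->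
  0 < T1 -> T1 < T2 -> 0 < a1 < 1 -> 0 < a2 < 1 ->
  pressure c T2 a2 <= pressure c T1 a1 ->
  H c Tp aAp T1 a1 < H c Tp aAp T2 a2.
Proof.
  intros hc hTp hap h1 h12 ha1 ha2 hp.
  pose proof (ionization_le_of_pressure_le c T1 T2 a1 a2 hc h1 h12 ha1 ha2 hp)
    as ha.
  assert (hal : alpha c T1 a1 <= alpha c T2 a2) by (apply alpha_le; auto; lra).
  assert (hE : ionization_energy c T1 a1 <= ionization_energy c T2 a2)
    by (apply ionization_energy_le; auto; lra).
  pose proof (alpha_pos c T1 a1 hc ha1) as hal1.
  pose proof (alpha_pos c Tp aAp hc hap) as halp.
  pose proof (pressure_pos c T2 a2 hc ha2) as hp2.
  pose proof (pressure_pos c Tp aAp hc hap) as hpp.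
  unfold H.
  set (p1 := pressure c T1 a1) in *.
  set (p2 := pressure c T2 a2) in *.
  set (pp := pressure c Tp aAp) in *.
  set (al1 := alpha c T1 a1) in *.
  set (al2 := alpha c T2 a2) in *.
  set (alp := alpha c Tp aAp) in *.
  assert (hq : pp / p1 <= pp / p2) by (apply Rdiv_le_cross; nra).
  assert (hq1 : 0 < pp / p1) by (apply Rdiv_lt_0_compat; lra).
  assert (hr : p2 / pp <= p1 / pp) by (apply Rdiv_le_cross; nra).
  (* The strictness of the whole comparison comes from T1 < T2 here. *)
  assert (hl : T1 * (1 + al1) < T2 * (1 + al2)) by nra.
  assert (hl1 : 0 < T1 * (1 + al1)) by nra.
  assert (hgas : T1 * (1 + al1) * (4 + pp / p1) < T2 * (1 + al2) * (4 + pp / p2))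
    by nra.
  (* This term enters [H] with a minus sign, hence the reversed order. *)
  assert (hbase : Tp * (1 + alp) * (4 + p2 / pp) <= Tp * (1 + alp) * (4 + p1 / pp))
    by (apply Rmult_le_compat_l; nra).
  lra.
Qed.

Theorem theorem7 (c : constants) (hc : admissible c)
  (Tp aAp : R) (hTp : 0 < Tp) (haAp : 0 < aAp < 1)
  (aA : R -> R) (haA : is_hugoniot_locus c Tp aAp aA) :
  forall T1 T2 : R, 0 < T1 -> T1 < T2 ->
    pressure c T1 (aA T1) < pressure c T2 (aA T2).
Proof.
  intros T1 T2 h1 h12.
  destruct (haA T1 h1) as [ha1 hH1].
  destruct (haA T2 (Rlt_trans _ _ _ h1 h12)) as [ha2 hH2].
  destruct (Rlt_le_dec (pressure c T1 (aA T1)) (pressure c T2 (aA T2)))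
    as [h | h]; [exact h|].
  pose proof (H_lt_of_pressure_le c Tp aAp T1 T2 (aA T1) (aA T2)
    hc hTp haAp h1 h12 ha1 ha2 h).
  lra.
Qed.
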